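(* Let $S$, $C$ and $L$ be the sufficiency, conditionality and likelihood relations on the set $\mathcal{I}$ of inference bases, and let $\overline{S\cup C}$ be the smallest equivalence relation on $\mathcal{I}$ containing $S\cup C$. Then $S\cup C\subset L\subset\overline{S\cup C}$.
   Context: A relation on a set $D$ is a subset $R\subset D\times D$; $\bar{R}$ denotes the equivalence relation generated by $R$, i.e. the smallest equivalence relation on $D$ containing $R$. A (discrete) model is $E=(\mathcal{X}_E,\{f_{E,\theta}:\theta\in\Theta_E\})$, where $\mathcal{X}_E$ is a nonempty countable (possibly finite) sample space, $\Theta_E$ is a nonempty parameter set, and each $f_{E,\theta}$ is a probability function on $\mathcal{X}_E$ (nonnegative with total sum 1). An inference base is a pair $I=(E,x)$ with $E$ a model and $x\in\mathcal{X}_E$ (the observed data). $\mathcal{I}$ is the set of all inference bases (all sets drawn from a fixed universe). Write $I_i=(E_i,x_i)$. Likelihood relation $L$: $(I_1,I_2)\in L$ iff $\Theta_{E_1}=\Theta_{E_2}$ and there is $c>0$ with $f_{E_1,\theta}(x_1)=c f_{E_2,\theta}(x_2)$ for every $\theta$. A statistic on $E$ is a function with domain $\mathcal{X}_E$. Sufficiency is understood pointwise: $m$ is sufficient for $E$ if $m(x)=m(y)$ implies that there is $k>0$ with $f_{E,\theta}(x)=k f_{E,\theta}(y)$ for all $\theta$; $m$ is minimal sufficient if it is sufficient and is a function of every sufficient statistic (equivalently, $m(x)=m(y)$ iff such a $k>0$ exists). The marginal model induced by $m$ has sample space $m(\mathcal{X}_E)$, parameter set $\Theta_E$ and probability functions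 $t\mapsto\sum_{x:m(x)=t}f_{E,\theta}(x)$. Sufficiency relation $S$: $(I_1,I_2)\in S$ iff $\Theta_{E_1}=\Theta_{E_2}$ and there exist minimal sufficient statistics $m_1$ for $E_1$ and $m_2$ for $E_2$ such that the marginal models induced by $m_1$ and $m_2$ are the same and $m_1(x_1)=m_2(x_2)$. A statistic $a$ is ancillary for $E$ if for each value $t$ the probability $\sum_{x:a(x)=t}f_{E,\theta}(x)$ does not depend on $\theta$. If $a$ is ancillary and $a(x_0)$ has positive probability $q$, the conditional model given $a(x_0)$ has sample space $\{x\in\mathcal{X}_E:a(x)=a(x_0)\}$, parameter set $\Theta_E$, and probability functions $x\mapsto f_{E,\theta}(x)/q$. Conditionality relation $C$: $(I_1,I_2)\in C$ iff $\Theta_{E_1}=\Theta_{E_2}$ and, possibly after exchanging the roles of $I_1$ and $I_2$, there is an ancillary statistic $a$ for $E_1$, with $a(x_1)$ having positive probability, such that the conditional model of $E_1$ given $a(x_1)$, with data $x_1$, is $(E_2,x_2)$ up to labelling of sample points: there is a bijection from $\{x:a(x)=a(x_1)\}$ onto $\mathcal{X}_{E_2}$ that sends $x_1$ to $x_2$ and carries the conditional probability function to $f_{E_2,\theta}$ for every $\theta$. *)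

(* Defs.v *)
From mathcomp Require Import all_boot all_order all_algebra.
From mathcomp Require Import all_classical all_reals all_analysis.
From Stdlib Require Import RelationClasses.

Set Implicit Arguments.
Unset Strict Implicit.
Unset Printing Implicit Defensive.

Import Order.TTheory GRing.Theory Num.Theory.

Local Open Scope classical_set_scope.
Local Open Scope ring_scope.

Definition is_equivalence (D : Type) (Q : set (D * D)) : Prop :=
  Equivalence (fun x y => Q (x, y)).

Definition generated_equivalence (D : Type) (Q : set (D * D)) : set (D * D) :=
  smallest (@is_equivalence D) Q.

(* Sample spaces are subsets of the universe U, parameter sets are subsets of
   the universe V.  The axioms are kept apart in [is_model], so that marginal
   and conditional models can be formed as plain data. *)
Record model_data (R : realType) (V : Type) (U : choiceType) := ModelData {
  sample : set U;
  params : set V;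
  pdf : V -> U -> R }.

(* [pdf_off] (extension by zero) makes the Leibniz equality of model data
   coincide with equality of models: it says that the sample spaces, the
   parameter sets and the probability functions agree. *)
Record is_model (R : realType) (V : Type) (U : choiceType)
    (E : model_data R V U) : Prop := IsModel {
  sample_neq0 : sample E !=set0;
  sample_countable : countable (sample E);
  params_neq0 : params E !=set0;
  pdf_ge0 : forall theta x, params E theta -> sample E x ->
    0 <= pdf E theta x;
  pdf_sum1 : forall theta, params E theta ->
    (\esum_(x in sample E) (pdf E theta x)%:E = 1)%E;
  pdf_off : forall theta x, ~ (params E theta /\ sample E x) ->
    pdf E theta x = 0 }.

Record inference_base (R : realType) (V : Type) (U : choiceType) :=
  InferenceBase {
    model : model_data R V U;
    data : U;
    modelP : is_model model;
    dataP : sample model data }.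

Section Relations.
Variables (R : realType) (V : Type) (U : choiceType).
Implicit Types (E : model_data R V U) (I J : inference_base R V U).

Definition prob E (theta : V) (A : set U) : R :=
  fine (\esum_(x in sample E `&` A) (pdf E theta x)%:E).

Definition likelihood_proportional E (x y : U) : Prop :=
  exists2 k : R, 0 < k &
    forall theta, params E theta -> pdf E theta x = k * pdf E theta y.

(* A statistic on E is represented by a function U -> U, of which only the
   restriction to [sample E] ever matters. *)
Definition sufficient E (m : U -> U) : Prop :=
  forall x y, sample E x -> sample E y -> m x = m y ->
    likelihood_proportional E x y.

Definition minimal_sufficient E (m : U -> U) : Prop :=
  sufficient E m /\
  forall s : U -> U, sufficient E s ->
    exists g : U -> U, forall x, sample E x -> m x = g (s x).

Definition marginal E (m : U -> U) : model_data R V U :=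
  {| sample := m @` sample E;
     params := params E;
     pdf := fun theta t => prob E theta [set x | m x = t] |}.

Definition ancillary E (a : U -> U) : Prop :=
  forall t theta theta', params E theta -> params E theta' ->
    prob E theta [set x | a x = t] = prob E theta' [set x | a x = t].

(* The conditional model given a(x0); when a is ancillary, the denominator is
   the same number for all parameter values. *)
Definition conditional E (a : U -> U) (x0 : U) : model_data R V U :=
  {| sample := sample E `&` [set x | a x = a x0];
     params := params E;
     pdf := fun theta x =>
       if `[< a x = a x0 >]
       then pdf E theta x / prob E theta [set y | a y = a x0] else 0 |}.

Definition likelihood_relation :
    set (inference_base R V U * inference_base R V U) :=
  [set p | params (model p.1) = params (model p.2) /\
    exists2 c : R, 0 < c &
      forall theta, params (model p.1) theta ->
        pdf (model p.1) theta (data p.1) =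
        c * pdf (model p.2) theta (data p.2)].

Definition sufficiency_relation :
    set (inference_base R V U * inference_base R V U) :=
  [set p | params (model p.1) = params (model p.2) /\
    exists m1 m2 : U -> U,
      [/\ minimal_sufficient (model p.1) m1,
          minimal_sufficient (model p.2) m2,
          marginal (model p.1) m1 = marginal (model p.2) m2 &
          m1 (data p.1) = m2 (data p.2)]].

Definition same_up_to_labelling E (x : U) E' (x' : U) : Prop :=
  params E = params E' /\
  exists h : U -> U,
    [/\ set_bij (sample E) (sample E') h,
        h x = x' &
        forall theta y, params E theta -> sample E y ->
          pdf E' theta (h y) = pdf E theta y].

Definition conditional_base I J : Prop :=
  exists a : U -> U,
    [/\ ancillary (model I) a,
        forall theta, params (model I) theta ->
          0 < prob (model I) theta [set x | a x = a (data I)] &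
        same_up_to_labelling (conditional (model I) a (data I)) (data I)
          (model J) (data J)].

Definition conditionality_relation :
    set (inference_base R V U * inference_base R V U) :=
  [set p | params (model p.1) = params (model p.2) /\
    (conditional_base p.1 p.2 \/ conditional_base p.2 p.1)].

End Relations.

Arguments likelihood_relation : clear implicits.
Arguments sufficiency_relation : clear implicits.
Arguments conditionality_relation : clear implicits.

(* Main.v *)
Require Import Defs.
From mathcomp Require Import all_boot all_order all_algebra.
From mathcomp Require Import all_classical all_reals all_analysis.

Set Implicit Arguments.
Unset Strict Implicit.
Unset Printing Implicit Defensive.

Import Order.TTheory GRing.Theory Num.Theory.

Local Open Scope classical_set_scope.
Local Open Scope ring_scope.

(** The inclusion of the union of sufficiency and conditionality in likelihood
    is a pair of local computations. If m is sufficient, all the points of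
    the class of x have probability functions proportional to that of x with
    ratios free of theta, so the marginal probability of m x is a positive
    multiple of f_theta x, and equal marginal models force proportional
    likelihoods ([sufficiency_sub_likelihood]). Conditioning on an ancillary
    statistic divides f_theta x by a number free of theta
    ([conditionality_sub_likelihood]).

    The other inclusion is Birnbaum's argument. Given two inference bases I
    and J with proportional likelihoods, toss a fair coin and perform the
    experiment of I or that of J, recording which one was performed: this is
    the model [mixture]. The identity of the component is ancillary with
    probability 1/2 for each outcome ([ancillary_component]), and conditioning
    on it gives back the component ([conditional_mixture]); hence I and J are
    each related by conditionality to the mixture, observed at the point that
    encodes their own data. These two points of the mixture have proportional
    likelihoods, so a minimal sufficient statistic
    ([minimal_sufficient_exists]) takes the same value at both, which relates
    them by sufficiency. The chain I, mixture, mixture, J links I to J.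

    The mixture must have its sample space inside the universe U. Its
    points are pairs of a boolean and a sample point, which form a countable
    set, so they can be encoded in any infinite U ([countable_code]). *)

(** * Unordered sums *)

Lemma esumZl (R : realType) (T : choiceType) (S : set T) (r : R)
    (a : T -> \bar R) :
  0 <= r -> (forall x, S x -> (0 <= a x)%E) ->
  (\esum_(x in S) (r%:E * a x) = r%:E * \esum_(x in S) a x)%E.
Proof.
move=> r0 a0; rewrite /esum -ereal_supZl//; last first.
  by apply/set0P; exists (\sum_(x \in set0) a x)%E, set0 => //; exact: fsets_set0.
congr ereal_sup; rewrite image_comp; apply/eq_imagel => X [finX XS] /=.
rewrite !fsbig_finite//= !big_seq ge0_sume_distrr// => x.
by rewrite in_fset_set// inE => /XS/a0.
Qed.

Lemma esum_bool (R : realType) (a : bool -> \bar R) :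
  (forall b, 0 <= a b)%E ->
  (\esum_(b in [set: bool]) a b = a true + a false)%E.
Proof.
move=> a0; have finb : finite_set [set: bool] by exact: finite_finset.
rewrite esum_fset// fsbig_finite//= (perm_big [:: true; false]).
  by rewrite 2!big_cons big_nil; congr (_ + _)%E; exact: addr0.
apply: uniq_perm => [|//|]; first exact: finmap.fset_uniq.
by case; rewrite in_fset_set// in_setT.
Qed.

(** * Encoding a countable set in an infinite type *)

Lemma infinite_nat_inj (U : Type) :
  infinite_set [set: U] -> exists u : nat -> U, injective u.
Proof.
elim/Ppointed: U => U infU.
  exfalso; apply: infU; rewrite (_ : [set: U] = set0)// -subset0 => x.
  by case: (no x).
have /infiniteP/pcard_injP[u uinj] := infU.
by exists u => i j; apply: uinj; rewrite inE.
Qed.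

Lemma countable_code (T U : Type) (D : set T) : infinite_set [set: U] ->
  countable D -> D !=set0 ->
  exists (code : T -> U) (decode : U -> T), {in D, cancel code decode}.
Proof.
move=> /infinite_nat_inj[u uinj] /countable_injP[n ninj] [p _].
exists (u \o n), ('pinv_(fun=> p) D (u \o n)).
by apply: pinvKV => x y xD yD /uinj; exact: ninj.
Qed.

(** * Probabilities, sufficiency and minimal sufficiency *)

Section Sufficiency.
Variables (R : realType) (V : Type) (U : choiceType).
Implicit Types (E : model_data R V U) (theta : V) (x y : U) (A : set U).

Lemma likelihood_proportional_refl E x : likelihood_proportional E x x.
Proof. by exists 1 => // theta _; rewrite mul1r. Qed.

Lemma likelihood_proportional_sym E x y :
  likelihood_proportional E x y -> likelihood_proportional E y x.
Proof.
move=> [k k0 xy]; exists k^-1; rewrite ?invr_gt0// => theta /xy->.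
by rewrite mulKf// gt_eqF.
Qed.

Lemma likelihood_proportional_trans E x y z :
  likelihood_proportional E x y -> likelihood_proportional E y z ->
  likelihood_proportional E x z.
Proof.
move=> [k k0 xy] [l l0 yz]; exists (k * l); first exact: mulr_gt0.
by move=> theta Ptheta; rewrite xy// yz// mulrA.
Qed.

(** [prob] takes the real part of an extended sum; in a model no information
    is lost, because the sum is at most 1. *)
Lemma esum_probE E theta A : is_model E -> params E theta ->
  (\esum_(x in sample E `&` A) (pdf E theta x)%:E = (prob E theta A)%:E)%E.
Proof.
move=> EP Ptheta; rewrite /prob fineK// ge0_fin_numE; last first.
  by apply: esum_ge0 => x [Ex _]; rewrite lee_fin pdf_ge0.
rewrite (le_lt_trans _ (ltry 1))// -(pdf_sum1 EP Ptheta).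
rewrite (esumID A (sample E)) ?leeDl//.
  by apply: esum_ge0 => x [Ex _]; rewrite lee_fin pdf_ge0.
by move=> x Ex; rewrite lee_fin pdf_ge0.
Qed.

Lemma prob_trivial E theta A (P : Prop) : is_model E -> params E theta ->
  (forall x, sample E x -> A x <-> P) -> prob E theta A = (`[< P >])%:R.
Proof.
move=> EP Ptheta AP; case: asboolP => p.
  rewrite /prob (_ : _ `&` _ = sample E) ?pdf_sum1//.
  by apply/seteqP; split=> [x []//|x Ex]; split=> //; apply/AP.
rewrite /prob (_ : _ `&` _ = set0) ?esum_set0//.
by rewrite -subset0 => x [Ex /(AP _ Ex)].
Qed.

Lemma pdf_le_prob E theta A x : is_model E -> params E theta ->
  sample E x -> A x -> pdf E theta x <= prob E theta A.
Proof.
move=> EP Ptheta Ex Ax; rewrite -lee_fin -esum_probE//.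
apply: esum_ge; exists [set x]; last by rewrite fsbig_set1.
by split=> // _ ->.
Qed.

(** Factorization: the probability of the class of [x] is [pdf E theta x] times
    the sum of the ratios of the likelihoods in the class to that of [x]. If
    the likelihood of [x] is positive at some [theta0], this sum can be read
    off at [theta0]; if it is identically zero, so is the probability of the
    class, and any constant will do. *)
Lemma sufficient_prob E (m : U -> U) x : is_model E -> sufficient E m ->
  sample E x -> exists2 K : R, 0 < K & forall theta, params E theta ->
    prob E theta [set y | m y = m x] = K * pdf E theta x.
Proof.
move=> EP suff Ex.
have [[theta0 Pth0 fx0]|fx0] := pselect (exists2 theta0, params E theta0 &
    pdf E theta0 x != 0); last first.
  have {}fx0 theta : params E theta -> pdf E theta x = 0.
    by move=> Ptheta; apply/eqP/negP => /negP ne0; apply: fx0; exists theta.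
  exists 1 => // theta Ptheta; rewrite fx0// mulr0 /prob esum1// => y [Ey myx].
  by have [k _ ->] := suff _ _ Ey Ex myx; rewrite ?fx0 ?mulr0.
have {}fx0 : 0 < pdf E theta0 x by rewrite lt_neqAle eq_sym fx0 pdf_ge0.
exists (prob E theta0 [set y | m y = m x] / pdf E theta0 x).
  by rewrite divr_gt0//; apply: lt_le_trans fx0 _; exact: pdf_le_prob.
move=> theta Ptheta; apply: EFin_inj.
rewrite mulrAC -mulrA mulrC EFinM -!esum_probE//.
rewrite -esumZl; last 2 first.
- by rewrite divr_ge0 ?pdf_ge0.
- by move=> y [Ey _]; rewrite lee_fin pdf_ge0.
apply: eq_esum => y [Ey myx]; have [k k0 fyx] := suff _ _ Ey Ex myx.
by rewrite -EFinM !fyx// [k * pdf E theta0 x]mulrC mulrA divfK ?gt_eqF// mulrC.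
Qed.

(** Sending each sample point to a representative of its class under
    proportionality of likelihoods is minimal sufficient. The second
    conclusion is the half of the characterization of minimal sufficiency
    that relates two data points by sufficiency. *)
Lemma minimal_sufficient_exists E : sample E !=set0 ->
  exists2 m : U -> U, minimal_sufficient E m &
    forall x y, likelihood_proportional E x y -> m x = m y.
Proof.
move=> [e Ee].
pose cls x := [set y | sample E y /\ likelihood_proportional E y x].
pose m x := xget e (cls x).
have mP x : sample E x -> cls x (m x).
  move=> Ex; rewrite /m; case: xgetP => [y ->//|/(_ x) []].
  by split=> //; exact: likelihood_proportional_refl.
have m_const x y : likelihood_proportional E x y -> m x = m y.
  move=> xy; congr (xget e _); apply/seteqP.
  split=> z [Ez zx]; split=> //.
    exact: likelihood_proportional_trans zx xy.
  exact/(likelihood_proportional_trans zx)/likelihood_proportional_sym.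
exists m; last exact: m_const.
split=> [x y Ex Ey mxy|s suffs].
  have [_ mx] := mP _ Ex; have [_ my] := mP _ Ey.
  apply: (likelihood_proportional_trans (likelihood_proportional_sym mx)).
  by rewrite mxy.
(* A sufficient [s] determines [m]: pull its value back to any sample point. *)
exists (fun t => m (xget e [set y | sample E y /\ s y = t])) => x Ex.
case: xgetP => [y _ [Ey syx]|/(_ x) []//]; apply: m_const.
by apply: suffs => //; rewrite syx.
Qed.

End Sufficiency.

(** * Sufficiency and conditionality imply proportional likelihoods *)

Section Inclusions.
Variables (R : realType) (V : Type) (U : choiceType).
Implicit Types (I J : inference_base R V U).

Lemma sufficiency_sub_likelihood :
  sufficiency_relation R V U `<=` likelihood_relation R V U.
Proof.
move=> [I J] [/= parIJ [m1 [m2 [[suff1 _] [suff2 _] mar12 m12]]]].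
split=> //=.
have [K1 K1gt0 m1E] := sufficient_prob (modelP I) suff1 (dataP I).
have [K2 K2gt0 m2E] := sufficient_prob (modelP J) suff2 (dataP J).
exists (K1^-1 * K2); first by rewrite mulr_gt0 ?invr_gt0.
move=> theta Ptheta; apply: (mulfI (lt0r_neq0 K1gt0)).
rewrite -m1E// -!mulrA mulVKf ?gt_eqF// -m2E -?parIJ// m12.
exact: (congr1 (fun E => pdf E theta (m2 (data J))) mar12).
Qed.

(** The constant is the probability of the conditioning event, which does not
    depend on the parameter; it is read off at any one parameter value. *)
Lemma conditional_base_likelihood I J : params (model I) = params (model J) ->
  conditional_base I J -> likelihood_relation R V U (I, J).
Proof.
move=> parIJ [a [anc a_gt0 [_ [h [_ hI pdfJ]]]]]; split=> //=.
have [theta0 Ptheta0] := params_neq0 (modelP I).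
exists (prob (model I) theta0 [set x | a x = a (data I)]); first exact: a_gt0.
move=> theta Ptheta; rewrite -hI pdfJ//=; last by split=> //; exact: dataP.
by rewrite asboolT// (anc _ theta0 theta)// mulrCA divff ?mulr1// gt_eqF// a_gt0.
Qed.

Lemma likelihood_relation_sym I J :
  likelihood_relation R V U (I, J) -> likelihood_relation R V U (J, I).
Proof.
move=> [/= parIJ [c c0 IJ]]; split=> //=; exists c^-1; first by rewrite invr_gt0.
by move=> theta; rewrite -parIJ => /IJ->; rewrite mulKf ?gt_eqF.
Qed.

Lemma conditionality_sub_likelihood :
  conditionality_relation R V U `<=` likelihood_relation R V U.
Proof.
move=> [I J] [/= parIJ [IJ|JI]]; first exact: conditional_base_likelihood.
by apply: likelihood_relation_sym; exact: conditional_base_likelihood.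
Qed.

End Inclusions.

(** * The mixture of two models with the same parameters *)

Section Mixture.
Variables (R : realType) (V : Type) (U : choiceType).
Variables (E : bool -> model_data R V U) (code : bool * U -> U)
  (decode : U -> bool * U).

Definition tagged_sample : set (bool * U) :=
  [set: bool] `*`` (fun b => sample (E b)).

(** A point of the mixture is the code of a sample point tagged with the
    component from which it comes; the test extends the probability function
    by zero, as [pdf_off] requires. *)
Definition mixture : model_data R V U :=
  {| sample := code @` tagged_sample;
     params := params (E true);
     pdf := fun theta z => if `[< (code @` tagged_sample) z >]
       then 2^-1 * pdf (E (decode z).1) theta (decode z).2 else 0 |}.

Hypothesis codeK : {in tagged_sample, cancel code decode}.
Hypothesis EP : forall b, is_model (E b).
Hypothesis parE : forall b, params (E b) = params (E true).

Lemma codeE b x : sample (E b) x -> decode (code (b, x)) = (b, x).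
Proof. by move=> Ex; apply: codeK; rewrite inE. Qed.

Lemma mixture_sample b x : sample (E b) x -> sample mixture (code (b, x)).
Proof. by move=> Ex; exists (b, x). Qed.

Lemma pdf_mixture theta b x : sample (E b) x ->
  pdf mixture theta (code (b, x)) = 2^-1 * pdf (E b) theta x.
Proof. by move=> Ex /=; rewrite asboolT ?codeE//; exists (b, x). Qed.

(** The total probability formula. It is stated for extended sums because
    [mixture_model] needs the total mass itself, not only its real part. *)
Lemma esum_mixture theta A : params mixture theta ->
  (\esum_(z in sample mixture `&` A) (pdf mixture theta z)%:E =
   (2^-1 * (prob (E true) theta [set x | A (code (true, x))] +
            prob (E false) theta [set x | A (code (false, x))]))%:E)%E.
Proof.
move=> Ptheta.
have -> : sample mixture `&` A = code @` ([set: bool] `*``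
    (fun b => sample (E b) `&` [set x | A (code (b, x))])).
  apply/seteqP; split=> [z [[[b x] [_ /= Ex] <-] Az]|z [[b x] [_ /= [Ex Az]] <-]].
    by exists (b, x).
  by split=> //; exists (b, x).
rewrite esum_image; last first.
  move=> [b x] [c y] /[!inE] -[_ /= [Ex _]] [_ /= [Ey _]] /(congr1 decode).
  by rewrite !codeE.
rewrite (eq_esum (b := fun k => (2^-1%:E * (pdf (E k.1) theta k.2)%:E)%E));
  last by move=> [b x] [_ [Ex _]]; rewrite pdf_mixture// EFinM.
have ge0 b x : (0 <= (pdf (E b) theta x)%:E)%E.
  rewrite lee_fin; have [Ex|Ex] := pselect (sample (E b) x).
    by rewrite pdf_ge0// parE.
  by rewrite (pdf_off (EP b))// => -[].
rewrite esumZl ?invr_ge0// EFinM; congr (_ * _)%E.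
rewrite -(esum_esum (a := fun b x => (pdf (E b) theta x)%:E));
  last by move=> b x _ _; exact: ge0.
rewrite (eq_esum (b := fun b => (prob (E b) theta [set x | A (code (b, x))])%:E)).
  by rewrite esum_bool// => b; rewrite -esum_probE// ?parE//; exact: esum_ge0.
by move=> b _; rewrite esum_probE ?parE.
Qed.

Lemma prob_mixture theta A : params mixture theta ->
  prob mixture theta A =
  2^-1 * (prob (E true) theta [set x | A (code (true, x))] +
          prob (E false) theta [set x | A (code (false, x))]).
Proof. by move=> Ptheta; rewrite {1}/prob esum_mixture. Qed.

Lemma mixture_model : is_model mixture.
Proof.
split.
- have [x Ex] := sample_neq0 (EP true).
  by exists (code (true, x)); exact: mixture_sample.
- apply: sub_countable (card_image_le _ _) _; apply: countableXR => // b _.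
  exact: sample_countable.
- exact: (params_neq0 (EP true)).
- move=> theta _ Ptheta [[b x] [_ Ex] <-].
  by rewrite pdf_mixture// mulr_ge0 ?invr_ge0 ?pdf_ge0 ?parE.
- move=> theta Ptheta; rewrite -[sample _]setIT esum_mixture//.
  rewrite !(@prob_trivial _ _ _ _ _ _ True) ?parE//= asboolT// -mulr2n.
  by rewrite mulVf// pnatr_eq0.
- move=> theta z off /=; case: asboolP => // -[[b x] [_ Ex] zE]; rewrite -zE codeE//=.
  rewrite (pdf_off (EP b)) ?mulr0// => -[]; rewrite parE => Ptheta _.
  by apply: off; split=> //; exists (b, x).
Qed.

Variable x0 : bool -> U.
Hypothesis x0E : forall b, sample (E b) (x0 b).

(** The statistic that tells which component was performed. Its values must lie
    in [U], so each component is represented by the code of its data. *)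
Definition component (z : U) : U :=
  let b := (decode z).1 in code (b, x0 b).

Lemma component_code b x : sample (E b) x ->
  component (code (b, x)) = code (b, x0 b).
Proof. by move=> Ex; rewrite /component codeE. Qed.

(** The event that [component] equals [t] contains either all of a component of
    the mixture or none of it, so its probability does not involve [theta]. *)
Lemma prob_component theta t : params mixture theta ->
  prob mixture theta [set z | component z = t] =
  2^-1 * ((`[< code (true, x0 true) = t >])%:R +
          (`[< code (false, x0 false) = t >])%:R).
Proof.
move=> Ptheta; rewrite prob_mixture//; congr (_ * (_ + _));
  by apply: prob_trivial; rewrite ?parE// => x Ex /=; rewrite component_code.
Qed.

Lemma ancillary_component : ancillary mixture component.
Proof. by move=> t theta theta' *; rewrite !prob_component. Qed.

Lemma code_neq b : code (~~ b, x0 (~~ b)) <> code (b, x0 b).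
Proof. by move=> /(congr1 decode); rewrite !codeE// => -[]; case: b. Qed.

Lemma prob_component_half theta b : params mixture theta ->
  prob mixture theta [set z | component z = component (code (b, x0 b))] = 2^-1.
Proof.
move=> Ptheta; rewrite prob_component// component_code//.
have := @code_neq b.
case: b => /= ne; rewrite (asboolT (erefl _)) (asboolF ne).
  by rewrite addr0 mulr1.
by rewrite add0r mulr1.
Qed.

(** Forgetting the tag is the relabelling; the weight 1/2 cancels against the
    probability of the conditioning event. *)
Lemma conditional_mixture b :
  same_up_to_labelling
    (conditional mixture component (code (b, x0 b))) (code (b, x0 b))
    (E b) (x0 b).
Proof.
have inv z : sample mixture z -> component z = component (code (b, x0 b)) ->
    exists2 x, sample (E b) x & z = code (b, x).
  move=> [[c x] [_ /= Ex] <-]; rewrite !component_code// => /(congr1 decode).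
  by rewrite !codeE// => -[cb _]; move: Ex; rewrite cb; exists x.
split; first by rewrite parE.
exists (fun z => (decode z).2); split.
- split.
  + by move=> z [Mz /= cz]; have [x Ex ->] := inv _ Mz cz; rewrite codeE.
  + move=> y z /[!inE] -[/inv My cy] [/inv Mz cz].
    by have [x Ex ->] := My cy; have [x' Ex' ->] := Mz cz; rewrite !codeE//= => ->.
  + move=> x Ex; exists (code (b, x)); last by rewrite codeE.
    by split; [exact: mixture_sample | rewrite /= !component_code].
- by rewrite codeE.
move=> theta z Ptheta [Mz cz]; have [x Ex zE] := inv _ Mz cz.
transitivity (pdf mixture theta z /
  prob mixture theta [set y | component y = component (code (b, x0 b))]).
  rewrite prob_component_half// zE codeE// pdf_mixture// mulrC.
  by rewrite invrK mulVKf ?pnatr_eq0.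
by rewrite [RHS]/= asboolT.
Qed.

End Mixture.

Theorem theorem7 (R : realType) (V : Type) (U : choiceType)
    (U_infinite : infinite_set [set: U]) :
  let S := sufficiency_relation R V U in
  let C := conditionality_relation R V U in
  let L := likelihood_relation R V U in
  S `|` C `<=` L /\ L `<=` generated_equivalence (S `|` C).
Proof.
move=> S C L; split.
  move=> p [Sp|Cp]; first exact: sufficiency_sub_likelihood.
  exact: conditionality_sub_likelihood.
move=> [I J] [/= parIJ [c c0 fIJ]] Q [Qeq SCQ].
pose B b := if b then I else J.
pose E b := model (B b); pose x0 b := data (B b).
have EP b : is_model (E b) := modelP (B b).
have x0E b : sample (E b) (x0 b) := dataP (B b).
have parE b : params (E b) = params (E true) by case: b.
have [||code [decode codeK]] := countable_code (D := tagged_sample E) U_infinite.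
- by apply: countableXR => // b _; exact: sample_countable.
- by exists (true, x0 true); split=> //; exact: x0E.
pose M b := InferenceBase (mixture_model codeK EP parE)
  (mixture_sample code decode (x0E b)).
have MC b : C (M b, B b).
  split; [exact: esym (parE b)|left; exists (component code decode x0)]; split.
  - exact: ancillary_component.
  - by move=> theta Ptheta; rewrite prob_component_half ?invr_gt0.
  - exact: conditional_mixture.
have MS : S (M true, M false).
  split=> //=.
  have [m mP mE] := minimal_sufficient_exists (sample_neq0 (modelP (M true))).
  exists m, m; split=> //; apply: mE.
  exists c => // theta Ptheta.
  by rewrite !(pdf_mixture codeK)// [pdf (E true) _ _]fIJ// mulrCA.
have QC b : Q (M b, B b) by apply: SCQ; right; exact: MC.
have QS : Q (M true, M false) by apply: SCQ; left.
case: Qeq => _ Qsym Qtrans.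
apply: (Qtrans _ (M true)); first by apply: Qsym; exact: (QC true).
exact: Qtrans QS (QC false).
Qed.
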